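(* Let $\mathbb{M}$ be $\mathbb{R}$ or $\mathbb{C}$, let $B\subset\mathbb{N}$ be a nonempty finite set with cardinality $N$, let $\boldsymbol{\gamma}=(\gamma_k)$ be a driving sequence in $\mathbb{M}$ whose terms $\gamma_k$, $k\in B$, are nonzero and pairwise distinct, let $\boldsymbol{\xi}=(\xi_n)$ be a sequence in $\mathbb{M}$, and let $w_n(\boldsymbol{\gamma},N)\neq 0$, $n\in B$, be weights. For an arbitrary sequence $\mathbf{f}=(f_n)$ in $\mathbb{M}$ (with $f_n\neq0$ for at least one $n\in B$) let $g_k(t)=\mathcal{T}_{\gamma_k,B}^{f_n}(t)$, $k\in B$, be its discrete Taylor transformation driven by $\boldsymbol{\gamma}$. Then the discrete Taylor transformation of an arbitrary $\mathbf{f}$ is uniquely invertible with $$f_n=\mathcal{IT}_{\xi_n,B}^{g_k}(1)\qquad\text{for all } n\in B$$ (that is, this recovery formula holds for every such $\mathbf{f}$) if and only if $\boldsymbol{\xi}$ satisfies the orthogonality conditions $$\sum_{k\in B}\gamma_k^{l}\,\xi_n^{k}=w_n(\boldsymbol{\gamma},N)\,\delta_{nl}\qquad\text{for all } n,l\in B,$$ where $\delta_{nl}$ is Kronecker's delta.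
   Context: $\mathbb{N}=\{0,1,2,\ldots\}$; the convention $0^0=1$ is used. For $B\subset\mathbb{N}$ finite, the discrete Taylor transformation (DTT) of $\mathbf{f}$ driven by $\boldsymbol{\gamma}$ is the family of functions $$g_k(t)=\mathcal{T}_{\gamma_k,B}^{f_n}(t)=\frac1t\sum_{n\in B}f_n\frac{\gamma_k^n}{t^n},\qquad k\in B,$$ defined by this finite sum for $t\in\mathbb{M}$, $t\neq0$. The inverse DTT of $\mathbf{g}=(g_k)$ driven by $\boldsymbol{\xi}$ is $$\mathcal{IT}_{\xi_n,B}^{g_k}(t)=\frac{1}{t\,w_n(\boldsymbol{\gamma},N)}\sum_{k\in B}g_k(t)\frac{\xi_n^k}{t^k},\qquad n\in B,$$ where $w_n(\boldsymbol{\gamma},N)\neq0$ is a weight depending on $\boldsymbol{\gamma}$ and on the cardinality $N$ of $B$. In particular $g_k(1)=\sum_{n\in B}f_n\gamma_k^n$ and $\mathcal{IT}_{\xi_n,B}^{g_k}(1)=\frac{1}{w_n(\boldsymbol{\gamma},N)}\sum_{k\in B}g_k(1)\xi_n^k$. *)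

(* Defs.v *)
From mathcomp Require Import all_boot all_order all_algebra finmap.
From mathcomp Require Import complex.
From mathcomp Require Import reals.

Set Implicit Arguments.
Unset Strict Implicit.
Unset Printing Implicit Defensive.

Import GRing.Theory.
Local Open Scope ring_scope.

Inductive scalar_kind := RealScalars | ComplexScalars.

Definition scalars (R : realType) (s : scalar_kind) : fieldType :=
  match s with
  | RealScalars => R
  | ComplexScalars => R[i]
  end.

Section DiscreteTaylor.
Variable M : fieldType.
Implicit Types (B : {fset nat}) (f gamma xi : nat -> M) (c t : M).

(* Meaningful for t != 0 only; at t = 0 the value is an artefact of 0^-1 = 0.
   The convention 0^0 = 1 is that of ^+. *)
Definition dtt B f c t : M :=
  t^-1 * \sum_(n <- B) f n * (c ^+ n / t ^+ n).

(* The weight takes the index n, the whole driving sequence gamma and the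
   cardinality of B.  As for dtt, only t != 0 is meaningful. *)
Definition idtt B (w : nat -> (nat -> M) -> nat -> M) gamma xi
    (g : nat -> M -> M) (n : nat) t : M :=
  (t * w n gamma #|` B|)^-1 * \sum_(k <- B) g k t * (xi n ^+ k / t ^+ k).

End DiscreteTaylor.

(* Main.v *)
Require Import Defs.
From mathcomp Require Import all_boot all_order all_algebra finmap.
From mathcomp Require Import complex.
From mathcomp Require Import reals.

(** At t = 1 the inverse transform composed with the transform is a linear map
    acting on f through the matrix S n l = \sum_(k <- B) gamma k ^+ l * xi n ^+ k,
    up to the weights: interchanging the two finite sums
    ([idtt_dtt_at1]) shows that the n-th recovered value is
    (w n)^-1 * \sum_(l <- B) f l * S n l.  Recovery for every f thus says that
    the matrix with entries (w n)^-1 * S n l is the identity, which is the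
    family of orthogonality conditions.  In one direction it suffices to test
    recovery on the unit sequences supported at a single l of B, which read off
    the columns of S; in the other, S n l = w n * (n == l)%:R collapses the sum
    to its n-th term ([sum_seq_delta]). *)

Set Implicit Arguments.
Unset Strict Implicit.
Unset Printing Implicit Defensive.

Import GRing.Theory.
Local Open Scope ring_scope.
Local Open Scope fset_scope.

Section RecoveryMatrix.
Variable M : fieldType.
Implicit Types (B : {fset nat}) (f gamma xi : nat -> M).

Lemma sum_seq_delta B f n : n \in B ->
  \sum_(l <- B) f l * (n == l)%:R = f n.
Proof.
move=> nB; rewrite (bigD1_seq n) //= eqxx mulr1 big1 ?addr0 // => l.
by rewrite eq_sym => /negPf ->; rewrite mulr0.
Qed.

(** Both finite sums can be interchanged, so that the composite of the
    transform and its candidate inverse becomes a matrix acting on f. *)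
Lemma idtt_dtt_at1 B (w : nat -> (nat -> M) -> nat -> M) gamma xi f n :
  idtt B w gamma xi (fun k => dtt B f (gamma k)) n 1 =
  (w n gamma #|` B|)^-1 *
    \sum_(l <- B) f l * \sum_(k <- B) gamma k ^+ l * xi n ^+ k.
Proof.
rewrite /idtt /dtt mul1r; congr (_ * _).
under [RHS]eq_bigr => l _ do rewrite mulr_sumr.
rewrite [RHS]exchange_big /=; apply: eq_bigr => k _.
rewrite invr1 mul1r expr1n divr1 mulr_suml; apply: eq_bigr => l _.
by rewrite expr1n divr1 mulrA.
Qed.

End RecoveryMatrix.

Theorem theorem9 (R : realType) (s : scalar_kind) (B : {fset nat})
    (gamma xi : nat -> scalars R s)
    (w : nat -> (nat -> scalars R s) -> nat -> scalars R s)
    (B_neq0 : B != fset0)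
    (gamma_neq0 : forall k, k \in B -> gamma k != 0)
    (gamma_inj : {in B &, injective gamma})
    (w_neq0 : forall n, n \in B -> w n gamma #|` B| != 0) :
  (forall f : nat -> scalars R s,
     (exists2 n, n \in B & f n != 0) ->
     forall n, n \in B ->
       f n = idtt B w gamma xi (fun k => dtt B f (gamma k)) n 1)
  <->
  (forall n l, n \in B -> l \in B ->
     \sum_(k <- B) gamma k ^+ l * xi n ^+ k = w n gamma #|` B| * (n == l)%:R).
Proof.
split=> [recover n l nB lB | orth f _ n nB].
  (* The unit sequence at l extracts the l-th column of the matrix. *)
  have := recover (fun m => (l == m)%:R) _ n nB.
  rewrite idtt_dtt_at1; under eq_bigr => m _ do rewrite mulrC.
  rewrite sum_seq_delta // [n == l]eq_sym => -> //.
    by rewrite mulVKf ?w_neq0.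
  by exists l; rewrite // eqxx oner_neq0.
rewrite idtt_dtt_at1.
under eq_big_seq => l lB do rewrite orth // mulrCA.
by rewrite -mulr_sumr sum_seq_delta // mulKf ?w_neq0.
Qed.
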